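(* The infinite dihedral group, whose Cayley graph is the infinite ladder, has dimension sequence $(3,4,6,8,\ldots)$. That is, if $(X,d)$ is the vertex set of the infinite ladder graph with its graph metric, then $\dim_1(X)=3$ and $\dim_k(X)=2k$ for every integer $k\geq 2$.
   Context: The infinite ladder graph has vertex set $X=\{m+in: m\in\mathbb{Z},\ n\in\{0,1\}\}\subset\mathbb{C}$, with two vertices joined by an edge exactly when they are at Euclidean distance $1$ (so the edges join $m+in$ to $m+1+in$, and $m$ to $m+i$). It is the Cayley graph of the infinite dihedral group $\langle r,s \mid s^2=1,\ srs=r^{-1}\rangle$ with respect to the generating set $\{r,r^{-1},s\}$, where the vertices are the group elements and $g_1,g_2$ are joined by an edge iff $g_2=g_0g_1$ for some generator $g_0$. The graph metric $d(u,v)$ is the smallest number of edges in a path joining $u$ to $v$. For a metric space $(X,d)$ and a positive integer $k$, a subset $S\subset X$ is a $k$-metric generator for $X$ if for any two distinct points $u,v\in X$ there are at least $k$ distinct points $w\in S$ with $d(u,w)\neq d(v,w)$. $\dim_k(X)$ is the infimum of $|S|$ over all $k$-metric generators $S$ for $X$ (with $|S|=+\infty$ for infinite $S$ and $\inf\varnothing=+\infty$). The dimension sequence of $X$ is $(\dim_1(X),\dim_2(X),\dim_3(X),\ldots)$; the dimension sequence of a group with given generators is that of the vertex set of its Cayley graph with the graph metric. *)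

(* Defs.v *)
From HB Require Import structures.
From mathcomp Require Import all_boot all_order all_algebra.
From mathcomp Require Import all_classical all_reals all_analysis.
From mathcomp Require Import complex.

Set Implicit Arguments.
Unset Strict Implicit.
Unset Printing Implicit Defensive.

Import Order.TTheory GRing.Theory Num.Theory.

Local Open Scope classical_set_scope.
Local Open Scope card_scope.
Local Open Scope ring_scope.

Section MetricDimension.
Variables (R : realType) (T : choiceType) (d : T -> T -> R).

(* [`I_k #<= A] says that [A] has at least [k] elements; [A] may be infinite. *)
Definition k_metric_generator (k : nat) (S : set T) : Prop :=
  forall u v : T, u <> v -> `I_k #<= [set w | S w /\ d u w <> d v w].

(* [counting S] is [#|S|] for finite [S] and [+oo] otherwise, and
   [ereal_inf set0 = +oo]. *)
Definition metric_dim (k : nat) : \bar R :=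
  ereal_inf [set counting S | S in k_metric_generator k].

End MetricDimension.

(* [path e u p && (last u p == v)]: the walk [u :: p] goes from [u] to [v], with
   [size p] edges.  The value is junk ([inf set0 = 0]) when no walk exists. *)
Definition graph_dist (R : realType) (T : eqType) (e : rel T) (u v : T) : R :=
  inf [set (size p)%:R | p in [set p : seq T | path e u p && (last u p == v)]].

Definition ladder_vertex : choiceType := (int * 'I_2)%type.

Definition ladder_point (R : realType) (u : ladder_vertex) : R[i] :=
  (u.1%:~R +i* (u.2 : nat)%:R)%C.

Definition ladder_edge (R : realType) : rel ladder_vertex :=
  fun u v => `|ladder_point R u - ladder_point R v| == 1.

Definition cayley_edge (G : groupType) (gens : seq G) : rel G :=
  fun g1 g2 => has (fun g0 => g2 == (g0 * g1)%g) gens.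

Definition dihedral_relations (G : groupType) (r s : G) : Prop :=
  (s * s = 1)%g /\ (s * r * s = r^-1)%g.

(* [G] is the group presented by < r, s | s^2 = 1, srs = r^-1 >, expressed by
   the universal property of a presentation. *)
Definition infinite_dihedral (G : groupType) (r s : G) : Prop :=
  dihedral_relations r s /\
  forall (H : groupType) (a b : H), dihedral_relations a b ->
    exists2 f : {multiplicative G -> H}, f r = a /\ f s = b &
      forall g : {multiplicative G -> H}, g r = a /\ g s = b -> g =1 f.

Definition graph_iso (T U : Type) (e : rel T) (e' : rel U) : Prop :=
  exists2 f : T -> U, bijective f & forall x y, e' (f x) (f y) = e x y.

(* Main.v *)
(* In coordinates [(m, a)], [m] an integer and [a] a bit, the ladder metric is
   [|m - m'| + [a != a']].  The sets of points resolving the pair (0,0), (1,1)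
   and the pair (0,1), (1,0) are disjoint, which forces 2k points; k full columns
   suffice when k >= 2.  For k = 1, two points never suffice, and the three
   points (0,0), (0,1), (1,0) do.  The same coordinates describe the dihedral
   group through the normal form [s^a r^m], unique because the group law that
   it induces on pairs [(m, a)] is a group satisfying the relations. *)

From HB Require Import structures.
Require Import Defs.
From mathcomp Require Import all_boot all_order all_algebra.
From mathcomp Require Import all_classical all_reals all_analysis.
From mathcomp Require Import finmap complex zify ring.

Set Implicit Arguments.
Unset Strict Implicit.
Unset Printing Implicit Defensive.

Import Order.TTheory GRing.Theory Num.Theory.

Local Open Scope classical_set_scope.
Local Open Scope ring_scope.

(** * Cardinal bounds through duplicate-free sequences *)

Section Counting.
Variable T : choiceType.
Implicit Types (A : set T) (s : seq T).

Lemma seq_card_eq s : uniq s -> ([set` s] #= `I_(size s))%card.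
Proof.
move=> us; pose F := [fset x in s]%fset.
have -> : [set` s]%classic = [set` F]%classic.
  by apply/seteqP; split=> x /=; rewrite inE.
by apply/card_eq_fsetP; rewrite card_fseq undup_id.
Qed.

Lemma seq_card_geI A s : uniq s -> (forall x, x \in s -> A x) ->
  (`I_(size s) #<= A)%card.
Proof.
by move=> us sA; rewrite -(card_le_eql (seq_card_eq us)); exact: subset_card_le.
Qed.

(** Covers infinite [A] too: a finite subset with at least [k] elements is cut down to its first
    [k]. The resulting lists can be concatenated and counted. *)
Lemma card_geI_seq A k : (`I_k #<= A)%card ->
  exists s, [/\ uniq s, size s = k & forall x, x \in s -> A x].
Proof.
move=> kA.
have [F FA kF] : exists2 F : {fset T}, [set` F] `<=` A & (k <= #|` F|)%N.
  have [finA|infA] := pselect (finite_set A); last exact: infinite_set_fset.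
  exists (fset_set A); last exact: leq_card_fset_set.
  by rewrite fset_setK.
exists (take k F); split; rewrite ?take_uniq ?fset_uniq ?size_takel //.
by move=> x /mem_take/FA.
Qed.

Lemma le_counting (R : realType) A k : (`I_k #<= A)%card ->
  ((k%:R : R)%:E <= counting A)%E.
Proof.
move=> kA; rewrite /counting; case: asboolP => [finA|_]; last exact: leey.
by rewrite lee_fin ler_nat leq_card_fset_set.
Qed.

Lemma counting_seq (R : realType) s : uniq s ->
  counting [set` s] = (((size s)%:R : R)%:E)%E.
Proof.
move=> us; have sI := seq_card_eq us.
by rewrite /counting asboolT ?(card_fset_set sI) //.
Qed.

End Counting.

Lemma metric_dimE (R : realType) (T : choiceType) (d : T -> T -> R) k s :
  uniq s -> k_metric_generator d k [set` s] ->
  (forall S, k_metric_generator d k S -> (`I_(size s) #<= S)%card) ->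
  metric_dim d k = (size s)%:R%:E.
Proof.
move=> us gs lb; apply/eqP; rewrite eq_le; apply/andP; split.
  by apply: ereal_inf_lbound; exists [set` s] => //; exact: counting_seq.
by apply: le_ereal_inf_tmp => _ [S gS <-]; apply/le_counting/lb.
Qed.

(** * The ladder metric in coordinates *)

Definition ladder_dist (x y : int * bool) : nat :=
  `|x.1 - y.1|%N + (x.2 != y.2).

(** This is why two points, possibly equal, never form a generator. In one row, the pair sits just
    left of both points, one step away and one row off. In different rows, it consists of two
    opposite corners of a square between them, or of the two horizontal neighbours of [x] if the
    columns agree. *)
Lemma ladder_unresolved (x y : int * bool) : exists u v,
  [/\ u <> v, ladder_dist u x = ladder_dist v x
            & ladder_dist u y = ladder_dist v y].
Proof.
case: x y => [a p] [b q]; rewrite /ladder_dist /=.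
have [<-|pq] := eqVneq p q.
  exists (Num.min a b - 1, p), (Num.min a b, ~~ p); split.
  - by case; lia.
  - by case: p => /=; lia.
  - by case: p => /=; lia.
have [lt|gt|<-] := ltrgtP a b.
- by exists (a, q), (a + 1, p); split; [case; lia| |];
    case: p q pq => [] [] //=; lia.
- by exists (b, p), (b + 1, q); split; [case; lia| |];
    case: p q pq => [] [] //=; lia.
- by exists (a - 1, p), (a + 1, p); split; [case; lia| |];
    case: p q pq => [] [] //=; lia.
Qed.

(** * Distance and dimensions of any graph with ladder coordinates *)

Section LadderModel.
Variables (R : realType) (T : choiceType) (f : T -> int * bool).
Hypothesis f_bij : bijective f.

(** One edge changes [ladder_dist] to a fixed point by at most one, so no walk is shorter. A walk of
    exactly that length shows that the infimum is attained. *)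
Lemma ladder_graph_dist (e : rel T) :
  (forall x y, e x y = (ladder_dist (f x) (f y) == 1)%N) ->
  forall u v, graph_dist R e u v = (ladder_dist (f u) (f v))%:R.
Proof.
have [g fK gK] := f_bij; move=> eE u v.
have lb p : path e u p -> (ladder_dist (f u) (f (last u p)) <= size p)%N.
  elim: p u => [|w p IHp] u /=.
    by case: (f u) => m []; rewrite /ladder_dist /=; lia.
  rewrite eE => /andP[uw /IHp]; move: uw; rewrite /ladder_dist.
  by move: (f u) (f w) (f (last w p)) => [m []] [n []] [q []] /=; lia.
have [p up [lp sp]] : exists2 p, path e u p &
    last u p = v /\ size p = ladder_dist (f u) (f v).
  have [n uvn] : exists n, ladder_dist (f u) (f v) = n by eexists.
  rewrite uvn; move: uvn => {lb}.
  elim: n u => [|n IHn] u uv.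
    exists [::] => //; split => //; apply: (can_inj fK); move: uv.
    by case: (f u) (f v) => [m []] [m' []]; rewrite /ladder_dist /= => h;
      congr pair; lia.
  have [w uw wv] : exists2 w,
      ladder_dist (f u) w = 1%N & ladder_dist w (f v) = n.
    move: uv; case: (f u) (f v) => [m a] [m' b]; rewrite /ladder_dist /= => h.
    (* The walk moves towards the target column first and changes row only once there. *)
    have [lt|gt|eq_m] := ltrgtP m m'.
    - by exists (m + 1, a); case: a b h => [] [] /=; lia.
    - by exists (m - 1, a); case: a b h => [] [] /=; lia.
    - by exists (m, ~~ a); case: a b h => [] [] /=; lia.
  have [|p wp [lp sp]] := IHn (g w); first by rewrite gK.
  by exists (g w :: p); rewrite /= ?eE ?gK ?uw ?lp ?sp.
pose D : set R := [set (size q)%:R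
  | q in [set q : seq T | path e u q && (last u q == v)]].
have mem_uv : D (size p)%:R by exists p => //=; rewrite up lp eqxx.
have lb_uv : lbound D (ladder_dist (f u) (f v))%:R.
  by move=> _ [q /= /andP[/lb uq /eqP <-] <-]; rewrite ler_nat.
rewrite -sp in lb_uv *; apply/eqP; rewrite eq_le /graph_dist; apply/andP; split.
  by apply: ge_inf => //; exists (size p)%:R.
by apply: lb_le_inf => //; exists (size p)%:R.
Qed.

Variable d : T -> T -> R.
Hypothesis dE : forall u v, d u v = (ladder_dist (f u) (f v))%:R.

Lemma ladder_dim_ge k S : k_metric_generator d k S -> (`I_(2 * k) #<= S)%card.
Proof.
have [g fK gK] := f_bij; move=> gS.
have /gS/card_geI_seq[s [us sk sS]] : g (0, false) <> g (1, true).
  by move/(can_inj gK).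
have /gS/card_geI_seq[t [ut tk tS]] : g (0, true) <> g (1, false).
  by move/(can_inj gK).
have -> : (2 * k)%N = size (s ++ t) by rewrite size_cat sk tk mul2n addnn.
apply: seq_card_geI => [|x]; last first.
  by rewrite mem_cat => /orP[/sS[]|/tS[]].
(* Disjointness: [(m, 0)] resolves the first pair iff [m <= 0] and the second iff [m >= 1]; in row 1
   the roles are exchanged. *)
rewrite cat_uniq us ut andbT /=; apply/hasPn => x /tS[_ /= /eqP].
rewrite !dE !gK eqr_nat => xt; apply/negP => /sS[_ /= /eqP].
rewrite !dE !gK eqr_nat; move: xt; rewrite /ladder_dist /=.
by case: (f x) => m []; lia.
Qed.

Lemma ladder_dim1_ge S : k_metric_generator d 1 S -> (`I_3 #<= S)%card.
Proof.
have [g fK gK] := f_bij; move=> gS.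
(* A pair that neither [x] nor [y] resolves must be resolved by a further point of [S]. Three uses,
   the first from an arbitrary point, give three distinct elements. *)
have resolve x y : exists z, [/\ S z, z <> x & z <> y].
  have [u [v [uv ux vx]]] := ladder_unresolved (f x) (f y).
  have /gS/card_geI_seq[[|z [|? ?]] [_ // _ sS]] : g u <> g v.
    by move/(can_inj gK).
  have [/= Sz] := sS z (mem_head _ _); rewrite !dE !gK => /eqP; rewrite eqr_nat.
  by move=> /eqP uvz; exists z; split => // zE; rewrite zE in uvz.
have [x [Sx _ _]] := resolve (g (0, true)) (g (0, true)).
have [y [Sy /eqP yx _]] := resolve x x.
have [z [Sz /eqP zx /eqP zy]] := resolve x y.
apply: (@seq_card_geI _ _ [:: z; x; y]) => [|w].
  by rewrite /= !inE negb_or zx zy eq_sym yx.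
by rewrite !inE => /or3P[] /eqP ->.
Qed.

Lemma ladder_dim1 : metric_dim d 1 = 3%:R%:E.
Proof.
have [g fK gK] := f_bij.
pose s := [seq g x | x <- [:: (0, false); (0, true); (1, false)]].
apply: (@metric_dimE _ _ _ _ s) => [| |S]; last exact: ladder_dim1_ge.
  by rewrite map_inj_uniq //; exact: can_inj gK.
move=> u v uv.
have [x xs xuv] : exists2 x, x \in s & d u x != d v x.
  apply/hasP; apply: contra_notT uv => /hasPn h; apply: (can_inj fK).
  (* The distances to the two points of column 0 determine the row and [|m|]; the distance to
     [(1, 0)] then fixes the sign of [m]. *)
  have resolve x : x \in [:: (0, false); (0, true); (1, false)] ->
      ladder_dist (f u) x = ladder_dist (f v) x.
    move=> xs; apply/eqP; rewrite -(eqr_nat R) -[x]gK -!dE -[_ == _]negbK.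
    by apply: h; apply: map_f.
  move: (resolve (0, false) isT) (resolve (0, true) isT).
  move: (resolve (1, false) isT).
  by case: (f u) (f v) => [m []] [m' []]; rewrite /ladder_dist /=; move=> *;
     try (congr pair); lia.
apply: (@seq_card_geI _ _ [:: x]) => // y; rewrite inE => /eqP -> /=.
by split => //; apply/eqP.
Qed.

(* If some column resolves neither way, the pair lies in one row,
   symmetrically about that column, and every other column resolves it twice. *)
Lemma ladder_dim k : (2 <= k)%N -> metric_dim d k = (2 * k)%:R%:E.
Proof.
have [g fK gK] := f_bij; move=> k2.
pose s := [seq g (i%:Z, b) | i <- iota 0 k, b <- [:: false; true]].
have sz : (2 * k)%N = size s by rewrite size_allpairs size_iota mulnC.
have mem_s (i : nat) b : (i < k)%N -> g (i%:Z, b) \in s.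
  by move=> ik; apply: allpairs_f; rewrite ?mem_iota //; case: b.
rewrite sz; apply: metric_dimE => [| |S]; last by rewrite -sz; exact: ladder_dim_ge.
  apply: allpairs_uniq => //; first exact: iota_uniq.
  by move=> [i b] [j c] _ _ /(can_inj gK)[-> ->].
move=> u v uv.
suff [h [hinj hres]] : exists h : nat -> int * bool,
    {in gtn k &, injective h} /\
    forall i, (i < k)%N -> g (h i) \in s /\
      ladder_dist (f u) (h i) != ladder_dist (f v) (h i).
  rewrite -[k in `I_k](size_iota 0) -(size_map (g \o h)).
  apply: seq_card_geI => [|x xs]; last have /mapP[i + ->] := xs.
    rewrite map_inj_in_uniq ?iota_uniq // => i j; rewrite !mem_iota /= => ik jk.
    by move/(can_inj gK)/hinj; apply.
  rewrite mem_iota /= => /hres[si ri]; split => //.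
  by rewrite !dE gK; apply/eqP; rewrite eqr_nat.
pose res x := ladder_dist (f u) x != ladder_dist (f v) x.
pose col_res (i : nat) := res (i%:Z, false) || res (i%:Z, true).
have [/allP allres|/allPn[c]] := boolP (all col_res (iota 0 k)).
  (* Each column contributes its row-0 point if that resolves, and its row-1 point otherwise. *)
  exists (fun i : nat => (i%:Z, ~~ res (i%:Z, false))); split=> [i j _ _ []//|i ik].
  split; first exact: mem_s.
  have := allres i; rewrite /col_res mem_iota /= ik => /(_ isT).
  by rewrite -/(res _); case E : (res (_, false)) => //=; rewrite E.
rewrite mem_iota /col_res negb_or !negbK => ck /andP[/eqP c0 /eqP c1].
(* A column other than [c], namely 1 if [c = 0] and 0 otherwise; it is below [k] because [k >= 2].
   Its second point replaces the missing contribution of column [c]. *)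
pose c' : nat := (c == 0)%N.
exists (fun i : nat => if i == c then (c'%:Z, true) else (i%:Z, false)); split.
  by move=> i j _ _; do 2 case: eqP => [->|?] //; case.
move=> i ik; split.
  by case: eqP => _; apply: mem_s => //; rewrite /c'; case: eqP => _; lia.
have {uv} : f u <> f v by move/(can_inj fK).
move: c0 c1; rewrite /ladder_dist.
case: (f u) (f v) => [m p] [m' q] /= c0 c1 uv.
(* In different rows, the two equalities would make [|m - c| - |m' - c|] both 1 and -1. *)
have [epq emm] : p = q /\ m <> m'.
  by case: p q c0 c1 uv => [] [] /= c0 c1 uv; try (exfalso; lia);
    split=> // mm; apply: uv; rewrite mm.
rewrite -{}epq in c0 c1 *.
have ladder_ne (i' : int) b : i' <> c ->
    (`|(m - i')%R| + (p != b) != `|(m' - i')%R| + (p != b))%N.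
  by move=> i'c; rewrite eqn_add2r; case: p c0 c1 {uv} => /= c0 c1; lia.
case: (i =P c) => [_|ic]; last by apply: (ladder_ne i false); case.
apply: (ladder_ne c' true); rewrite /c'.
by case: (c =P 0%N) => [->|c0'] //= []; lia.
Qed.

End LadderModel.

(** * The infinite dihedral group and its normal form *)

Section Dihedral.

(* [(m, a)] stands for [s^a r^m]: with the exponent of [r] on the right, left
   multiplication by the generators preserves ladder adjacency. *)
Definition dihedral := (int * bool)%type.
HB.instance Definition _ := Choice.on dihedral.

(** The law comes from [r^m s = s r^-m]: moving the second factor's [s] to the left past [r^m]
    negates [m]. *)
Definition dihedral_mul (x y : dihedral) : dihedral :=
  ((if y.2 then - x.1 else x.1) + y.1, x.2 (+) y.2).
Definition dihedral_inv (x : dihedral) : dihedral :=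
  (if x.2 then x.1 else - x.1, x.2).

Fact dihedral_mulA : associative dihedral_mul.
Proof.
by move=> [m []] [n []] [p []]; rewrite /dihedral_mul /=; congr pair; lia.
Qed.
Fact dihedral_mul1g : left_id (0, false) dihedral_mul.
Proof. by move=> [m []]; rewrite /dihedral_mul /=; congr pair; lia. Qed.
Fact dihedral_mulg1 : right_id (0, false) dihedral_mul.
Proof. by move=> [m []]; rewrite /dihedral_mul /=; congr pair; lia. Qed.
Fact dihedral_mulVg : left_inverse (0, false) dihedral_inv dihedral_mul.
Proof. by move=> [m []]; rewrite /dihedral_mul /=; congr pair; lia. Qed.
Fact dihedral_mulgV : right_inverse (0, false) dihedral_inv dihedral_mul.
Proof. by move=> [m []]; rewrite /dihedral_mul /=; congr pair; lia. Qed.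

HB.instance Definition _ := isGroup.Build dihedral dihedral_mulA
  dihedral_mul1g dihedral_mulg1 dihedral_mulVg dihedral_mulgV.

Definition rot : dihedral := (1, false).
Definition refl : dihedral := (0, true).

Lemma dihedral_relations_model : dihedral_relations rot refl.
Proof. by []. Qed.

Definition expgz (G : groupType) (x : G) (n : int) : G :=
  match n with Posz n => (x ^+ n)%g | Negz n => (x ^- n.+1)%g end.

Lemma expgz_succ (G : groupType) (x : G) (n : int) :
  expgz x (n + 1) = (expgz x n * x)%g.
Proof.
case: n => [n|[|n]].
- by rewrite -PoszD addn1 /= expgSr.
- by rewrite /= expg1 mulVg.
- have -> : Negz n.+1 + 1 = Negz n by lia.
  by rewrite /= [in RHS]expgS invgM mulgVK.
Qed.

Lemma expgz_pred (G : groupType) (x : G) (n : int) :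
  expgz x (n - 1) = (expgz x n / x)%g.
Proof. by rewrite -[n in RHS](subrK 1) expgz_succ mulgK. Qed.

Lemma expgzD (G : groupType) (x : G) (m n : int) :
  expgz x (m + n) = (expgz x m * expgz x n)%g.
Proof.
elim/int_rect: n => [|n IHn|n IHn]; first by rewrite addr0 mulg1.
  by rewrite -addn1 PoszD addrA !expgz_succ IHn mulgA.
by rewrite -addn1 PoszD opprD addrA !expgz_pred IHn mulgA.
Qed.

Lemma gmulf_expgz (G H : groupType) (f : {multiplicative G -> H}) x n :
  f (expgz x n) = expgz (f x) n.
Proof.
(* [f] is only given as multiplicative; preservation of 1 follows by cancellation and gives access
   to the morphism lemmas on powers. *)
have f1 : f 1%g = 1%g by apply: (mulgI (f 1%g)); rewrite -gmulfM !mulg1.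
pose f' : UMagmaMorphism.type G H :=
  HB.pack (Multiplicative.sort f)
    (Multiplicative_isUMagmaMorphism.Build G H f f1).
by case: n => n /=; [exact: (gmulfXn f') | exact: (gmulfXVn f')].
Qed.

Lemma expgz_rot n : expgz rot n = (n, false).
Proof.
elim/int_rect: n => [//|n IHn|n IHn].
  by rewrite -addn1 PoszD expgz_succ IHn; congr pair.
by rewrite -addn1 PoszD opprD expgz_pred IHn; congr pair.
Qed.

Section Word.
Variables (G : groupType) (r s : G).
Hypothesis rs : dihedral_relations r s.

Definition dihedral_word (x : dihedral) : G :=
  (expgz s x.2%:Z * expgz r x.1)%g.

Lemma dihedral_swap (n : int) : (expgz r n * s = s * expgz r (- n))%g.
Proof.
have [ss srs] := rs.
have rsE : (r * s = s * r^-1)%g by rewrite -srs !mulgA ss mul1g.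
have rVsE : (r^-1 * s = s * r)%g by rewrite -srs -!mulgA ss mulg1.
elim/int_rect: n => [|n IHn|n IHn]; first by rewrite mulg1 mul1g.
  by rewrite -addn1 PoszD opprD expgz_pred expgz_succ -mulgA rsE !mulgA IHn.
rewrite -addn1 PoszD opprK opprD expgz_pred expgz_succ -mulgA rVsE !mulgA IHn.
by rewrite opprK.
Qed.

(** [dihedral_swap] brings the second [s] next to [s^a], where [s * s = 1] absorbs it if [a] is
    set. *)
Lemma dihedral_wordM : {morph dihedral_word : x y / (x * y)%g}.
Proof.
have [ss _] := rs.
move=> [m a] [n b]; rewrite /dihedral_word /= expgzD.
case: b => /=; last by rewrite addbF !mulgA mulg1.
rewrite addbT expg1 mulgA -[RHS]mulgA [(expgz r m * _)%g]mulgA dihedral_swap.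
by case: a => /=; rewrite !mulgA ?expg1 ?ss ?mul1g.
Qed.
End Word.

(** The universal property supplies [f] from [G] to the model, and the word map [w] goes back. Since
    [w \o f] fixes [r] and [s], uniqueness makes it the identity; [f \o w] is computed on normal
    forms. *)
Lemma infinite_dihedral_model (G : groupType) (r s : G) :
  infinite_dihedral r s ->
  exists2 f : G -> int * bool, bijective f &
    forall x y, cayley_edge [:: r; r^-1%g; s] x y =
      (ladder_dist (f x) (f y) == 1)%N.
Proof.
move=> [rs univ]; have [f [fr fs] _] := univ _ _ _ dihedral_relations_model.
pose w : {multiplicative dihedral -> G} :=
  HB.pack (dihedral_word r s)
    (isMultiplicative.Build _ _ _ (dihedral_wordM rs)).
have [h _ huniq] := univ _ _ _ rs.
have wr : w rot = r by rewrite /w /= /dihedral_word /= expg1 mul1g.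
have ws : w refl = s by rewrite /w /= /dihedral_word /= expg1 mulg1.
have fK : cancel f w.
  move=> x; rewrite -[w (f x)]/((w \o f) x) (huniq (w \o f)) /= ?fr ?fs //.
  by rewrite -(huniq idfun).
have wK : cancel w f.
  move=> [m a]; rewrite /w /= /dihedral_word gmulfM !gmulf_expgz fr fs /= expgz_rot.
  by case: a; congr pair; exact: add0r.
exists f; first by exists w.
(* In the model, left multiplication by [r] or its inverse shifts [m] by one, with a sign depending
   on the row, and [s] flips the row. *)
move=> x y; rewrite /cayley_edge /= orbF -!(inj_eq (can_inj fK)) !gmulfM.
rewrite -[(r^-1)%g]/(expgz r (-1)) gmulf_expgz fr fs expgz_rot.
by case: (f x) (f y) => [m []] [n []]; rewrite /ladder_dist /= !xpair_eqE /=; lia.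
Qed.
End Dihedral.

(** * The Euclidean ladder and the conclusion *)

Lemma ladder_edgeE (R : realType) (u v : ladder_vertex) :
  ladder_edge R u v =
    (ladder_dist (u.1, u.2 != ord0) (v.1, v.2 != ord0) == 1)%N.
Proof.
case: u v => [m i] [n j]; rewrite /ladder_edge /ladder_point /ladder_dist.
(* Squaring removes the root from the modulus, leaving a sum of two integer squares, which is 1 iff
   the sum of the absolute values is 1. *)
rewrite -(sqrp_eq1 (normr_ge0 _)) sqr_normc eq_complex.
have -> : (`|(m - n)%R| + ((i != ord0) != (j != ord0)) == 1)%N =
    ((m - n) ^+ 2 + (i%:Z - j%:Z) ^+ 2 == 1).
  have eq1 (x y : nat) : (y <= 1)%N ->
      (x + y == 1)%N = (x%:Z ^+ 2 + y%:Z ^+ 2 == 1).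
    by move=> y1; apply/eqP/eqP; nia.
  rewrite eq1; last by case: (_ != _).
  congr (_ + _ == _); first lia.
  by case: i j => [[|[|//]] ilt] [[|[|//]] jlt].
rewrite -(eqr_int R) !expr2 intrD !intrM !intrB -!pmulrn /=.
(* The imaginary part of a number times its conjugate vanishes. *)
rewrite [X in _ && (X == 0)](_ : _ = 0); last by ring.
by rewrite eqxx andbT; congr (_ == _); ring.
Qed.

Theorem theorem7p3 (R : realType) :
  (metric_dim (graph_dist R (ladder_edge R)) 1 = 3%:R%:E /\
   forall k : nat, (2 <= k)%N ->
     metric_dim (graph_dist R (ladder_edge R)) k = (2 * k)%:R%:E) /\
  (forall (G : groupType) (r s : G), infinite_dihedral r s ->
     let e := cayley_edge [:: r; r^-1%g; s] in
     graph_iso e (ladder_edge R) /\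
     metric_dim (graph_dist R e) 1 = 3%:R%:E /\
     forall k : nat, (2 <= k)%N ->
       metric_dim (graph_dist R e) k = (2 * k)%:R%:E).
Proof.
pose f (u : ladder_vertex) : int * bool := (u.1, u.2 != ord0).
have f_bij : bijective f.
  exists (fun x : int * bool => (x.1, inord x.2) : ladder_vertex).
    move=> [m i]; congr pair; apply/val_inj.
    rewrite /= inordK; last by case: eqP.
    by case: i => [[|[|//]] ilt].
  by move=> [m b]; congr pair; rewrite /= -val_eqE /= inordK; case: b.
split.
  have dE := ladder_graph_dist R f_bij (@ladder_edgeE R).
  split=> [|k k2]; first exact: (ladder_dim1 f_bij dE).
  exact: (ladder_dim f_bij dE k2).
move=> G r s /infinite_dihedral_model[h h_bij eE] e.
have dE := ladder_graph_dist R h_bij eE.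
split; last first.
  split=> [|k k2]; first exact: (ladder_dim1 h_bij dE).
  exact: (ladder_dim h_bij dE k2).
have [f' fK f'K] := f_bij.
(* Both graphs have the same coordinates, so the isomorphism goes from [G] to coordinates and back
   to ladder vertices. *)
exists (f' \o h) => [|x y].
  by apply: bij_comp h_bij; exists f.
by rewrite ladder_edgeE -!/(f _) /= !f'K [RHS]eE.
Qed.
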